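(* Let $(X,\|\cdot\|)$ be a normed plane. Let $B=\{x\in X : \|x-x_B\|\le R\}$ be a closed ball, let $n\ge 1$, and for $i=1,\dots,n$ let $A_i=\{x\in X : \|x-x_{A_i}\|<r_i\}$ be open balls with $r_i<R$. Put $A=\bigcap_{i=1}^n A_i$. If $A$ is not contained in $B$ (that is, $A\setminus B$ is non-empty), then $A\setminus B$ is contractible.
   Context: A normed plane is a two-dimensional real vector space equipped with an arbitrary norm; it carries the topology of the norm. A topological space is contractible if its identity map is homotopic to a constant map to one of its points. *)

(* Defs.v *)
From HB Require Import structures.
From mathcomp Require Import all_boot all_order all_algebra.
From mathcomp Require Import all_classical all_reals topology normedtype.
Set Implicit Arguments.
Unset Strict Implicit.
Unset Printing Implicit Defensive.
Import Order.TTheory GRing.Theory Num.Theory.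
Import numFieldNormedType.Exports.
Local Open Scope classical_set_scope.
Local Open Scope ring_scope.

(* Finite-dimensional vector spaces with an arbitrary norm. The topology comes
   from the norm; the vectType part only provides the dimension. *)
#[short(type="normedVectType")]
HB.structure Definition NormedVector (R : numDomainType) :=
  {V of NormedModule R V & Vector R V}.

(* The homotopy H is a total function on T * R of which only the restriction
   to T * [0, 1] matters. Continuity of f and g follows from that of H. *)
Definition homotopic (R : realType) (T U : topologicalType) (f g : T -> U) :=
  exists H : T * R -> U,
    [/\ {within [set: T] `*` `[0, 1]%classic, continuous H},
        (forall x, H (x, 0) = f x) &
        (forall x, H (x, 1) = g x)].

Definition contractible (R : realType) (T : topologicalType) :=
  exists p : T, homotopic R (@id T) (fun=> p).

(* Main.v *)
Require Import Defs.
From HB Require Import structures.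
From mathcomp Require Import all_boot all_order all_algebra.
From mathcomp Require Import all_classical all_reals topology normedtype.
From mathcomp Require Import derive ring lra.
Set Implicit Arguments.
Unset Strict Implicit.
Unset Printing Implicit Defensive.
Import Order.TTheory GRing.Theory Num.Theory.
Import numFieldNormedType.Exports.
Local Open Scope classical_set_scope.
Local Open Scope ring_scope.

(** Let [c] and [rB] be the centre and radius of [B], let [a] be the centre of
    one of the balls [A_i], and put [d := a - c] and [E := A \ B].

    A point of [E] is nearer to [a] than [rB] and farther from [c] than [rB],
    so by convexity of the norm it never enters [B] when it moves in the
    direction [d] ([ray_outside_ball]).  Hence on each line parallel to [d] the
    set [E] is an upper part of the convex set [A], and [E] has convex fibres
    over the quotient of the plane by the line spanned by [d].

    The image of [E] in this quotient is an interval.  If a segment joins two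
    points of [E] and a point [z] of it lies in [B], then every point of [B]
    above [z] (in the direction [d]) lies in all the [A_i]
    ([cap_sub_smaller_ball]): the ball [A_i] is the image of the interior of
    [B] under a homothety of ratio less than 1.  As the upper boundary of [B]
    is concave, the height of the upper boundary of [A_i] above it grows when
    one moves, transversally to [d], towards the centre of the homothety; and
    it is positive at both ends of the segment, one of which is on the far side
    of [z] from that centre.  This argument uses that [A_i] has the smaller
    radius and that the quotient is a line.  So the ray from [z] leaves [B]
    before it leaves [A], and by the intermediate value theorem it meets [E].

    Finally [E] is open with convex fibres over an interval, hence contractible
    ([contractible_of_fibres]): a continuous choice of a point of [E] above
    each point of the segments that join points of [E] ([fibre_selection])
    allows first to slide every point of [E] along its fibre to the chosen
    point, and then to follow the chosen points above the segment to a base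
    point. *)

(** * Convexity of balls *)

Lemma norm_convex (K : numDomainType) (V : normedModType K) (l : K) (u v : V) :
  0 <= l <= 1 -> `|l *: u + (1 - l) *: v| <= l * `|u| + (1 - l) * `|v|.
Proof.
move=> /andP[l0 l1]; rewrite (le_trans (ler_normD _ _)) // !normrZ.
by rewrite !ger0_norm ?subr_ge0.
Qed.

Lemma convex_comb_in_ball (R : realFieldType) (V : normedModType R) (a x y : V)
    (r l : R) :
  0 <= l <= 1 -> `|x - a| < r -> `|y - a| < r ->
  `|l *: x + (1 - l) *: y - a| < r.
Proof.
move=> l01 xa ya.
have -> : l *: x + (1 - l) *: y - a = l *: (x - a) + (1 - l) *: (y - a).
  by rewrite !scalerBr addrACA -opprD -scalerDl [l + _]addrC subrK scale1r.
apply: (le_lt_trans (norm_convex _ _ l01)).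
have : Num.max `|x - a| `|y - a| < r by rewrite gt_max xa.
apply: le_lt_trans; set M := Num.max _ _.
have xM : `|x - a| <= M by rewrite le_max lexx.
have yM : `|y - a| <= M by rewrite le_max lexx orbT.
by move/andP: l01 => [l0 l1]; nra.
Qed.

Lemma between_in_ball (R : realFieldType) (V : normedModType R) (a x d : V)
    (r s t : R) :
  `|x - a| < r -> `|x + s *: d - a| < r -> 0 <= t <= s -> `|x + t *: d - a| < r.
Proof.
move=> xa ya /andP[t0 ts].
have [s0|s0] := eqVneq s 0.
  by have -> : t = 0 by [lra]; rewrite scale0r addr0.
have sgt0 : 0 < s by rewrite lt_neqAle eq_sym s0 (le_trans t0).
have l01 : 0 <= t / s <= 1.
  by rewrite divr_ge0 ?(ltW sgt0) //= ler_pdivrMr // mul1r.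
have := convex_comb_in_ball l01 ya xa.
rewrite scalerDr scalerA divfK // [_ *: x + _ + _]addrAC -scalerDl.
by rewrite [_ / _ + _]addrC subrK scale1r.
Qed.

(** As [x - c] is the barycentre of [x + s (a - c) - c] and [x - a] with
    weights [1] and [s], one of these is at least as long as it, and the second
    is shorter. *)
Lemma ray_outside_ball (R : realFieldType) (V : normedModType R) (c a x : V)
    (rB s : R) :
  0 <= s -> `|x - a| <= rB -> rB < `|x - c| -> rB < `|x + s *: (a - c) - c|.
Proof.
move=> s0 xa xc.
have E : (1 + s) *: (x - c) = (x + s *: (a - c) - c) + s *: (x - a).
  rewrite scalerDl scale1r [x + _ - c]addrAC -[RHS]addrA -scalerDr.
  by congr (_ + s *: _); rewrite [RHS]addrC addrA subrK.
have : `|(1 + s) *: (x - c)| <= `|x + s *: (a - c) - c| + s * `|x - a|.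
  by rewrite E (le_trans (ler_normD _ _)) // normrZ (ger0_norm s0).
rewrite normrZ ger0_norm; last by rewrite addr_ge0.
nra.
Qed.

Lemma dist_lipschitz (R : numDomainType) (V : normedZmodType R) (c x y : V) :
  `|x - c| <= `|y - c| + `|x - y|.
Proof. by have := ler_normD (x - y) (y - c); rewrite addrA subrK [X in _ <= X]addrC. Qed.

(** * A smaller ball contains the caps of a larger one *)

(** The planar core, in the affine coordinates in which [N al be] is the
    distance from the centre of a ball [B] of radius [rB] to
    [o + al (x - o) + be d].  Here [b = (kappa, e)] is a point of [B], [z] lies
    [t] below it, and [rho] is the ratio of the homothety centred at [o], the
    origin of the coordinates.  The claim is that the image of [b] is interior
    to [B] when those of [x = (1, 0)] and [z] are, provided that [B] does not
    meet the upward ray from [x].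

    Since [B] contains the segment from [rho x] to [b] but no point above [x],
    the point [b] lies below the line through [o] and [x].  Then [rho b] lies
    on the vertical segment from [rho z] to a point of the segment between
    [rho x] and [b], and the end [rho z] is interior to [B]. *)
Lemma dilation_below_cap (R : realFieldType) (N : R -> R -> R)
    (rB rho kappa e t : R) :
  (forall l a a' b b', 0 <= l <= 1 ->
     N (l * a + (1 - l) * a') (l * b + (1 - l) * b')
       <= l * N a b + (1 - l) * N a' b') ->
  1 < rho -> 0 <= kappa < 1 -> 0 <= t ->
  N rho 0 < rB -> N (rho * kappa) (rho * (e - t)) < rB -> N kappa e <= rB ->
  (forall s, 0 <= s -> rB < N 1 s) ->
  N (rho * kappa) (rho * e) < rB.
Proof.
move=> convN rho1 /andP[k0 k1] t0 Nx Nz Nb out.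
have dpos : 0 < rho - kappa by lra.
have dneq : rho - kappa != 0 by rewrite gt_eqF.
have e0 : e < 0.
  rewrite ltNge; apply/negP => e0.
  (* weight at which the segment from rho x to b passes above or below x *)
  pose tau := (rho - 1) / (rho - kappa).
  have tau0 : 0 <= tau by rewrite divr_ge0; lra.
  have tau1 : tau <= 1 by rewrite ler_pdivrMr // mul1r; lra.
  have := convN tau kappa rho e 0; rewrite tau0 tau1 => /(_ isT).
  have -> : tau * kappa + (1 - tau) * rho = 1 by rewrite /tau; field.
  have := out (tau * e) (mulr_ge0 tau0 e0).
  rewrite mulr0 addr0; nra.
(* weight at which the segment from rho x to b is vertically above rho b *)
pose theta := kappa * (rho - 1) / (rho - kappa).
have th0 : 0 <= theta by rewrite divr_ge0 ?mulr_ge0; lra.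
have th1 : theta <= 1 by rewrite ler_pdivrMr // mul1r; nra.
have Nw : N (rho * kappa) ((1 - theta) * e) <= rB.
  have := convN theta rho kappa 0 e; rewrite th0 th1 => /(_ isT).
  have -> : theta * rho + (1 - theta) * kappa = rho * kappa.
    by rewrite /theta; field.
  rewrite mulr0 add0r; nra.
(* height of that point of the segment above rho b *)
pose gap := - e * (rho - 1 + theta).
have gap0 : 0 < gap by rewrite mulr_gt0; lra.
have rt0 : 0 <= rho * t by rewrite mulr_ge0; lra.
pose la := gap / (gap + rho * t).
have la0 : 0 < la by rewrite divr_gt0; lra.
have la1 : la <= 1 by rewrite ler_pdivrMr ?mul1r; lra.
have := convN la (rho * kappa) (rho * kappa) (rho * (e - t)) ((1 - theta) * e).
rewrite (ltW la0) la1 => /(_ isT).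
have -> : la * (rho * kappa) + (1 - la) * (rho * kappa) = rho * kappa by ring.
have -> : la * (rho * (e - t)) + (1 - la) * ((1 - theta) * e) = rho * e.
  have laE : la * (gap + rho * t) = gap by rewrite /la; field; lra.
  transitivity ((1 - theta) * e - la * (gap + rho * t)); last first.
    by rewrite laE /gap; ring.
  by rewrite /gap; ring.
nra.
Qed.

(** The point [o] is the centre of the homothety of ratio [rho] that maps [a]
    to [c].  It takes a ball centred at [a] to a ball centred at [c]. *)
Lemma homothety_centre (K : fieldType) (V : lmodType K) (c a : V) (rho : K) :
  rho != 1 -> exists o, forall v, o + rho *: (v - o) - c = rho *: (v - a).
Proof.
move=> rho1; exists ((rho - 1)^-1 *: (rho *: a - c)) => v; set o := _ *: _.
have oE : rho *: o = o + (rho *: a - c).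
  have : (rho - 1) *: o = rho *: a - c.
    by rewrite scalerA divff ?scale1r // subr_eq0.
  by move=> <-; rewrite scalerBl scale1r addrC subrK.
rewrite !scalerBr oE -[X in _ = _ - X](subrK c).
move: (rho *: a - c) (rho *: v) => p q.
by rewrite !opprD [q + (- o - _)]addrCA addNKr addrA.
Qed.

Lemma scaler_comb3 (K : pzRingType) (V : lmodType K) (l m a a' b b' c c' : K)
    (u v w : V) :
  l *: (a *: u + b *: v + c *: w) + m *: (a' *: u + b' *: v + c' *: w)
  = (l * a + m * a') *: u + (l * b + m * b') *: v + (l * c + m * c') *: w.
Proof. by rewrite !scalerDr !scalerA !scalerDl addrACA (addrACA (_ *: u)). Qed.

Lemma dilation_below_cap_normed (R : realFieldType) (V : normedModType R)
    (c a o d x z : V) (rB rho kappa e t : R) :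
  (forall v, o + rho *: (v - o) - c = rho *: (v - a)) ->
  1 < rho -> 0 <= kappa < 1 -> 0 <= t ->
  z - o = kappa *: (x - o) + (e - t) *: d ->
  rho * `|x - a| < rB -> rho * `|z - a| < rB -> `|z + t *: d - c| <= rB ->
  (forall s, 0 <= s -> rB < `|x + s *: d - c|) ->
  rho * `|z + t *: d - a| < rB.
Proof.
move=> ho rho1 k01 t0 zE xa za bc out.
pose N (al be : R) : R := `|1 *: (o - c) + al *: (x - o) + be *: d|.
have N1 v al be : v - o = al *: (x - o) + be *: d -> `|v - c| = N al be.
  by move=> vE; rewrite /N scale1r -addrA -vE addrC addrA subrK.
have Nrho v al be : v - o = al *: (x - o) + be *: d ->
    rho * `|v - a| = N (rho * al) (rho * be).
  move=> vE; rewrite -[X in X * _]gtr0_norm ?(lt_trans ltr01) // -normrZ -ho vE.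
  by rewrite /N scale1r scalerDr !scalerA addrAC -!addrA addrCA.
have bE : z + t *: d - o = kappa *: (x - o) + e *: d.
  by rewrite addrAC zE -addrA -scalerDl subrK.
have xE : x - o = 1 *: (x - o) + 0 *: d by rewrite scale1r scale0r addr0.
rewrite (Nrho _ _ _ bE); apply: (@dilation_below_cap _ N) t0 _ _ _ _ => //.
- move=> l al al' be be' l01; rewrite /N.
  apply: le_trans (norm_convex _ _ l01); rewrite scaler_comb3.
  by rewrite !mulr1 [l + _]addrC subrK.
- by rewrite -[rho]mulr1 -(mulr0 rho) -(Nrho _ _ _ xE).
- by rewrite -(Nrho _ _ _ zE).
- by rewrite -(N1 _ _ _ bE).
- move=> s s0; rewrite -(N1 (x + s *: d)) ?out //.
  by rewrite addrAC scale1r.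
Qed.

(** In the plane, this form is the coordinate on the quotient by the line
    spanned by [d]. *)
Lemma linear_form_kernel_sub_line (K : fieldType) (V : vectType K) (d : V) :
  \dim {:V} = 2%N -> d != 0 ->
  exists pi : {scalar V}, forall x, pi x = 0 -> exists k, x = k *: d.
Proof.
move=> dimV d0.
have [v vNd] : exists v, v \notin <[d]>%VS.
  apply/not_existsP => vd.
  have : ({:V} <= <[d]>)%VS.
    by apply/subvP => v _; apply/negPn/negP; apply: vd.
  by move/dimvS; rewrite dimV dim_vline d0.
have basisV : basis_of fullv [tuple v; d].
  rewrite basisEfree subvf /= dimV andbT free_cons span_seq1 vNd /=.
  by rewrite seq1_free.
pose i0 : 'I_2 := ord0; pose i1 : 'I_2 := ord_max.
have dec x : x = coord [tuple v; d] i0 x *: v + coord [tuple v; d] i1 x *: d.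
  rewrite {1}(coord_basis basisV (memvf x)) !big_ord_recl big_ord0 addr0 /=.
  by congr (_ + coord _ _ _ *: _); apply/val_inj.
exists (coord [tuple v; d] i0) => x x0.
by exists (coord [tuple v; d] i1 x); rewrite {1}(dec x) x0 scale0r add0r.
Qed.

(** Seen from [0], a nonzero point strictly between two distinct reals has one
    of them behind it. *)
Lemma convex_comb_shrinks (R : realFieldType) (u1 u2 l : R) :
  u1 != u2 -> 0 < l < 1 ->
  exists2 k : R, 0 <= k < 1 &
    l * u1 + (1 - l) * u2 = k * u1 \/ l * u1 + (1 - l) * u2 = k * u2.
Proof.
set u := _ + _; move=> u12 /andP[l0 l1].
have main v : 0 < u / v < 1 -> exists2 k : R, 0 <= k < 1 & u = k * v.
  move=> /andP[uv0 uv1]; exists (u / v); first by rewrite (ltW uv0).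
  by rewrite divfK //; apply: contraTneq uv0 => ->; rewrite invr0 mulr0 ltxx.
have end_beyond : 0 < u / u1 < 1 \/ 0 < u / u2 < 1 \/ u = 0.
  have [ulow|uhigh|->] := ltgtP u 0; last by right; right.
  - have [h|h|h] := ltgtP u1 u2; last by rewrite h eqxx in u12.
    + have uu : u1 < u by rewrite /u; nra.
      left; rewrite -(opprK u) -(opprK u1) invrN mulrNN.
      by rewrite divr_gt0 ?ltr_pdivrMr /=; lra.
    + have uu : u2 < u by rewrite /u; nra.
      right; left; rewrite -(opprK u) -(opprK u2) invrN mulrNN.
      by rewrite divr_gt0 ?ltr_pdivrMr /=; lra.
  - have [h|h|h] := ltgtP u1 u2; last by rewrite h eqxx in u12.
    + have uu : u < u2 by rewrite /u; nra.
      by right; left; rewrite divr_gt0 ?ltr_pdivrMr /=; lra.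
    + have uu : u < u1 by rewrite /u; nra.
      by left; rewrite divr_gt0 ?ltr_pdivrMr /=; lra.
case: end_beyond => [/main[k k01 ->]|[/main[k k01 ->]|->]].
- by exists k => //; left.
- by exists k => //; right.
- by exists 0; [rewrite lexx ltr01|left; rewrite mul0r].
Qed.

(** The points of the large ball that lie above a chord of it belong to every
    smaller ball that contains an extension of the chord whose ends [x], [y]
    are above the large ball.  One of the ends [x], [y] is separated from the
    centre [o] of the homothety by [z] along [pi] ([convex_comb_shrinks]), and
    [dilation_below_cap_normed] applies to this end; if [pi x = pi y], then [z]
    lies above [x] or [y], so it is outside of the large ball. *)
Lemma cap_sub_smaller_ball (R : realFieldType) (V : normedModType R)
    (pi : {scalar V}) (c a d x y : V) (rA rB l t : R) :
  (forall v, pi v = 0 -> exists k, v = k *: d) ->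
  let z := l *: x + (1 - l) *: y in
  rA < rB -> 0 <= l <= 1 -> 0 <= t ->
  `|x - a| < rA -> `|y - a| < rA ->
  (forall s, 0 <= s -> rB < `|x + s *: d - c|) ->
  (forall s, 0 <= s -> rB < `|y + s *: d - c|) ->
  `|z - c| <= rB -> `|z + t *: d - c| <= rB -> `|z + t *: d - a| < rA.
Proof.
move=> kerpi z rAB /andP[l0 l1] t0 xa ya outx outy zc bc.
have rA0 : 0 < rA by rewrite (le_lt_trans _ xa).
(* x, y and z on one line parallel to d *)
have [/eqP pixy|pixy] := boolP (pi x == pi y).
  have [k yE] : exists k, y - x = k *: d.
    by apply: kerpi; rewrite linearB /= pixy subrr.
  have [k0|k0] := leP 0 k.
    have /outx : 0 <= (1 - l) * k by rewrite mulr_ge0 // subr_ge0.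
    have -> : x + ((1 - l) * k) *: d = z.
      rewrite -scalerA -yE scalerBr addrCA [RHS]addrC; congr (_ + _).
      by rewrite scalerBl scale1r opprB addrC subrK.
    by rewrite ltNge zc.
  have /outy : 0 <= l * - k by rewrite mulr_ge0 // oppr_ge0 ltW.
  have -> : y + (l * - k) *: d = z.
    rewrite -scalerA scaleNr -yE opprB scalerBr addrCA.
    by rewrite /z scalerBl scale1r.
  by rewrite ltNge zc.
have l0' : l != 0.
  apply: contraTneq zc => l00; rewrite -ltNge /z l00 scale0r add0r subr0 scale1r.
  by have := outy 0 (lexx _); rewrite scale0r addr0.
have l1' : l != 1.
  apply: contraTneq zc => l11; rewrite -ltNge /z l11 subrr scale0r addr0 scale1r.
  by have := outx 0 (lexx _); rewrite scale0r addr0.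
have l01 : 0 < l < 1 by rewrite !lt_neqAle eq_sym l0' l1' l0.
pose rho := rB / rA.
have rho1 : 1 < rho by rewrite ltr_pdivlMr // mul1r.
have rhoE v : (rho * `|v - a| < rB) = (`|v - a| < rA).
  by rewrite mulrAC ltr_pdivrMr // ltr_pM2l // (lt_trans rA0).
have za : `|z - a| < rA by apply: convex_comb_in_ball; rewrite ?l0.
have [o ho] := homothety_centre c a (negbT (gt_eqF rho1)).
have pizo : pi (z - o) = l * pi (x - o) + (1 - l) * pi (y - o).
  rewrite /z !linearB linearD !linearZ /=; ring.
have pixyo : pi (x - o) != pi (y - o).
  by rewrite !linearB /= (inj_eq (addIr _)).
rewrite -rhoE.
have [k k01 [kE|kE]] := convex_comb_shrinks pixyo l01; rewrite -pizo in kE.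
- have [e eE] : exists e, (z - o) - k *: (x - o) = e *: d.
    by apply: kerpi; rewrite linearB linearZ /= kE subrr.
  apply: (dilation_below_cap_normed (kappa := k) (e := e + t) ho) outx; rewrite ?rhoE //.
  by rewrite addrK -eE [RHS]addrC subrK.
- have [e eE] : exists e, (z - o) - k *: (y - o) = e *: d.
    by apply: kerpi; rewrite linearB linearZ /= kE subrr.
  apply: (dilation_below_cap_normed (kappa := k) (e := e + t) ho) outy; rewrite ?rhoE //.
  by rewrite addrK -eE [RHS]addrC subrK.
Qed.

(** * Continuous selection in convex fibres *)

Lemma lipschitz_continuous (R : realFieldType) (V : normedModType R) (f : V -> R)
    (L : R) : (forall x y, f x <= f y + L * `|x - y|) -> continuous f.
Proof.
move=> fL x; apply/cvgrPdist_lt => eps eps0.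
have K0 : 0 < `|L| + 1 by rewrite ltr_wpDl.
have small : \forall y \near x, `|x - y| < eps / (`|L| + 1).
  by apply: cvgr_dist_lt; [exact: cvg_id|rewrite divr_gt0].
near=> y.
have : `|x - y| < eps / (`|L| + 1) by near: y.
rewrite ltr_pdivlMr // => xy.
have := fL x y; have := fL y x; rewrite distrC.
have : L * `|x - y| <= `|L| * `|x - y| by rewrite ler_wpM2r // ler_norm.
have := normr_ge0 (x - y).
by rewrite ltr_norml; move: `|x - y| xy => u; nra.
Unshelve. all: by end_near. Qed.

Definition segment_sup (R : realType) (C : R) (h : R -> R) : R :=
  sup [set h s | s in `[0, C]].

Lemma segment_sup_max (R : realType) (C : R) (h : R -> R) :
  0 <= C -> continuous h ->
  (exists2 s, 0 <= s <= C & segment_sup C h = h s) /\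
  (forall s, 0 <= s <= C -> h s <= segment_sup C h).
Proof.
move=> C0 hc.
have [s s0C smax] := EVT_max C0 (continuous_subspaceT hc).
have ub : ubound [set h u | u in `[0, C]] (h s).
  by move=> _ [u uC <-]; exact: smax.
have supE : segment_sup C h = h s.
  apply/eqP; rewrite eq_le ge_sup //=; last by exists (h s), s.
  by apply: ub_le_sup; [exists (h s)|exists s].
split; first by exists s => //; move: s0C; rewrite in_itv.
by move=> u uC; rewrite supE smax // in_itv.
Qed.

(** A supremum of functions that are uniformly Lipschitz in a parameter is
    Lipschitz in it, so that the maxima of [fibre_selection] are continuous in
    the base point. *)
Lemma segment_sup_lipschitz (R : realType) (V : normedModType R) (C L : R)
    (h : V -> R -> R) :
  0 <= C -> (forall x, continuous (h x)) ->
  (forall x y s, 0 <= s <= C -> h x s <= h y s + L * `|x - y|) ->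
  forall x y, segment_sup C (h x) <= segment_sup C (h y) + L * `|x - y|.
Proof.
move=> C0 hc hL x y.
have [[s sC ->] _] := segment_sup_max C0 (hc x).
have [_ ymax] := segment_sup_max C0 (hc y).
by rewrite (le_trans (hL x y s sC)) // lerD2r ymax.
Qed.

(** A continuous choice of a point in each fibre.  Let [g x] be the maximum of
    [m] on the segment [x + [0, C] d], which is positive if the segment meets
    [E].  The choice is the maximum over [0 <= s <= C] of the penalised height
    [s - K (1 - m (x + s d) / g x)].  It is at least [s1], a point where [m]
    attains [g x], because no penalty is paid there, and at most the point [s2]
    where it is attained.  This [s2] lies in [E]: the penalty outside of [E] is
    at least [K > C], which would make the maximum negative.  So the choice is
    between two points of the fibre. *)
Lemma fibre_selection (R : realType) (V : normedModType R) (E : set V) (d : V)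
    (C : R) (m : V -> R) :
  0 <= C ->
  (forall x, E x <-> 0 < m x) -> (forall x y, m x <= m y + `|x - y|) ->
  (forall x s t, E x -> E (x + s *: d) -> 0 <= t <= s -> E (x + t *: d)) ->
  exists S : V -> R, forall x, (exists2 s, 0 <= s <= C & E (x + s *: d)) ->
    [/\ 0 <= S x, E (x + S x *: d) & {for x, continuous S}].
Proof.
move=> C0 Em mL fib.
have mc : continuous m.
  by apply: (@lipschitz_continuous _ _ _ 1) => x y; rewrite mul1r.
have lc x : continuous (fun s : R => x + s *: d).
  move=> s; apply: cvgD; first exact: cvg_cst.
  exact: scalel_continuous.
have mlc x : continuous (fun s : R => m (x + s *: d)).
  by move=> s; apply: (continuous_comp (lc x s)); exact: mc.
pose g x := segment_sup C (fun s => m (x + s *: d)).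
have gL x y : g x <= g y + 1 * `|x - y|.
  apply: (segment_sup_lipschitz (h := fun x s => m (x + s *: d))) => //.
  move=> {}x {}y s _.
  by rewrite mul1r (le_trans (mL _ (y + s *: d))) // opprD addrACA subrr addr0.
pose K := C + 1.
pose h x s := s * g x + K * m (x + s *: d).
have hc x : continuous (h x).
  move=> s; apply: cvgD; apply: cvgM => //; try exact: cvg_cst.
  exact: mlc.
pose q x := segment_sup C (h x).
have qL x y : q x <= q y + (C + K) * `|x - y|.
  apply: (segment_sup_lipschitz (h := h)) => // {}x {}y s /andP[s0 sC].
  rewrite /h.
  have := mL (x + s *: d) (y + s *: d).
  rewrite opprD addrACA subrr addr0.
  have := gL x y; rewrite /K; have := normr_ge0 (x - y).
  move: (`|x - y|) (g x) (g y) (m _) (m _) => u v w a b u0 h1 h2.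
  have : s * v <= s * w + C * u by nra.
  nra.
(* q x / g x - K is the maximal penalised height *)
exists (fun x => q x / g x - K) => x [s0 s0C Es0].
have [[s1 s1C gE] gmax] := segment_sup_max C0 (mlc x).
have [[s2 s2C qE] qmax] := segment_sup_max C0 (hc x).
rewrite -/(g x) in gE gmax; rewrite -/(q x) in qE qmax.
have g0 : 0 < g x by rewrite (lt_le_trans _ (gmax _ s0C)) //; apply/Em.
have Es1 : E (x + s1 *: d) by apply/Em; rewrite -gE.
have lo : s1 <= q x / g x - K.
  by rewrite lerBrDr ler_pdivlMr // mulrDl {2}gE; exact: qmax.
have hi : q x / g x - K <= s2.
  rewrite lerBlDr ler_pdivrMr // qE mulrDl lerD2l ler_pM2l ?gmax //.
  by rewrite /K; lra.
have Es2 : E (x + s2 *: d).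
  apply/Em; rewrite ltNge; apply/negP => m0.
  have : q x / g x <= s2.
    rewrite ler_pdivrMr // qE /h gerDl pmulr_rle0 // /K; lra.
  move: lo s1C s2C; rewrite /K; lra.
split; first by case/andP: s1C => s10 _; exact: le_trans s10 lo.
  move: (q x / g x - K) lo hi => u lo hi.
  have := fib (x + s1 *: d) (s2 - s1) (u - s1) Es1.
  rewrite -!addrA -!scalerDl !(addrC s1) !subrK; apply=> //.
  by rewrite subr_ge0 lo lerD2r.
apply: cvgB; last exact: cvg_cst.
apply: cvgM; first exact: (lipschitz_continuous qL).
by apply: cvgV; [rewrite gt_eqF|exact: (lipschitz_continuous gL)].
Qed.

(** * Contractibility of a set with convex fibres *)

(** Clamping the time makes the homotopy total and continuous everywhere. *)
Definition clamp (R : realDomainType) (u : R) : R := Num.max 0 (Num.min 1 u).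

Lemma clamp_itv (R : realDomainType) (u : R) : 0 <= clamp u <= 1.
Proof. by rewrite le_max lexx ge_max ler01 ge_min lexx. Qed.

Lemma clamp_le0 (R : realDomainType) (u : R) : u <= 0 -> clamp u = 0.
Proof. by move=> u0; rewrite /clamp min_r ?max_l // (le_trans u0). Qed.

Lemma clamp_ge1 (R : realDomainType) (u : R) : 1 <= u -> clamp u = 1.
Proof. by move=> u1; rewrite /clamp min_l ?max_r. Qed.

Lemma clamp_continuous (R : realFieldType) : continuous (@clamp R : R -> R).
Proof.
apply: (@lipschitz_continuous _ _ _ 1) => x y; rewrite mul1r /clamp.
have := ler_norm (x - y); have := normr_ge0 (x - y).
move: `|x - y| => u u0 xy.
rewrite ge_max addr_ge0 ?le_max ?lexx //= ge_min.
have [h|h] := leP 1 y; first by rewrite -[X in X <= _]addr0 lerD //= le_max lexx orbT.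
apply/orP; right; rewrite (@le_trans _ _ (y + u)) ?lerD2r ?le_max ?lexx ?orbT //.
by lra.
Qed.

(** Convex fibres along [d], and segments between points of [E] that stay below
    [E], within bounded distance.  Let [S] be a continuous choice of fibre
    points.  In the first half of the homotopy [x] climbs to [x + S x d]; in
    the second half the base point moves from [x] straight to [p], and the
    image stays at the chosen point above it. *)
Lemma contractible_of_fibres (R : realType) (V : normedModType R) (E : set V)
    (d : V) (C : R) (m : V -> R) :
  0 <= C ->
  (forall x, E x <-> 0 < m x) -> (forall x y, m x <= m y + `|x - y|) ->
  (forall x s t, E x -> E (x + s *: d) -> 0 <= t <= s -> E (x + t *: d)) ->
  (forall x y l, E x -> E y -> 0 <= l <= 1 ->
     exists2 s, 0 <= s <= C & E (l *: x + (1 - l) *: y + s *: d)) ->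
  E !=set0 -> contractible R E.
Proof.
move=> C0 Em mL fib joined [p Ep].
have [S Sprop] := fibre_selection C0 Em mL fib.
(* la is 1 on the second half, nu is 1 on the first half and 0 at time 1 *)
pose nu (t : R) := clamp (2 - 2 * t).
pose la (t : R) := clamp (2 * t).
pose base (z : set_type E * R) := nu z.2 *: set_val z.1 + (1 - nu z.2) *: p.
pose F (z : set_type E * R) := base z + (la z.2 * S (base z)) *: d.
have valE (x : set_type E) : E (set_val x) by exact: set_valP.
have baseP z : exists2 s, 0 <= s <= C & E (base z + s *: d).
  by apply: joined => //; exact: clamp_itv.
have FE z : E (F z).
  have [S0 ES _] := Sprop _ (baseP z).
  have [la0 la1] := andP (clamp_itv (2 * z.2)).
  have [t2|t2] := leP z.2 (1 / 2).
    have bE : base z = set_val z.1.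
      by rewrite /base /nu clamp_ge1 ?scale1r ?subrr ?scale0r ?addr0 //; lra.
    apply: (fib _ (S (base z))) => //; first by rewrite bE.
    by rewrite mulr_ge0 //= ler_piMl.
  by rewrite /F /la clamp_ge1 ?mul1r //; lra.
have Fc : continuous F.
  have c1 : continuous (fun z : set_type E * R => set_val z.1 : V).
    move=> z; apply: (continuous_comp (f := fst)); first exact: cvg_fst.
    exact: initial_continuous.
  have affine_c (a b : R) : continuous (fun z : set_type E * R => clamp (a + b * z.2)).
    move=> z; apply: (continuous_comp (f := fun z : set_type E * R => a + b * z.2));
      last exact: clamp_continuous.
    apply: cvgD; first exact: cvg_cst.
    by apply: cvgM; [exact: cvg_cst|exact: cvg_snd].
  have nuc : continuous (fun z : set_type E * R => nu z.2).
    by move=> z; under eq_fun do rewrite /nu -mulNr; exact: affine_c.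
  have lac : continuous (fun z : set_type E * R => la z.2).
    move=> z; under eq_fun do rewrite /la -[2 * _]add0r; exact: affine_c.
  have bc : continuous base.
    move=> z; apply: cvgD; first by apply: cvgZ; [exact: nuc|exact: c1].
    apply: cvgZ; last exact: cvg_cst.
    by apply: cvgB; [exact: cvg_cst|exact: nuc].
  move=> z; apply: cvgD; first exact: bc.
  apply: cvgZ; last exact: cvg_cst.
  apply: cvgM; first exact: lac.
  apply: (continuous_comp (bc z)).
  by have [] := Sprop _ (baseP z).
pose H (z : set_type E * R) : set_type E := exist _ (F z) (mem_set (FE z)).
exists (H (exist _ p (mem_set Ep), 1)), H; split.
- apply: continuous_subspaceT; apply: continuous_comp_initial; exact: Fc.
- move=> x; apply/val_inj; rewrite /= /F /base /la /nu /=.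
  rewrite [clamp (2 * 0)]clamp_le0 ?mulr0 // clamp_ge1 ?subr0 ?ler1n //.
  by rewrite scale1r subrr scale0r addr0 mul0r scale0r addr0.
- move=> x; apply/val_inj; rewrite /= /F /base /la /nu /=.
  by rewrite [clamp (2 - _)]clamp_le0 ?mulr1 ?subrr // !scale0r.
Qed.

(** * Intersections of balls minus a larger ball *)

Theorem mainTheorem1 (R : realType) (X : normedVectType R)
    (dimX : \dim {:X} = 2%N)
    (xB : X) (rB : R)
    (n : nat) (n_ge1 : (1 <= n)%N) (xA : 'I_n -> X) (rA : 'I_n -> R)
    (rA_lt : forall i, rA i < rB) :
  let B := [set x : X | `|x - xB| <= rB] in
  let A := \bigcap_(i in [set: 'I_n]) [set x : X | `|x - xA i| < rA i] in
  ~ (A `<=` B) -> contractible R (A `\` B).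
Proof.
move=> B A /existsNP[p /not_implyP[Ap NBp]].
pose i0 : 'I_n := Ordinal n_ge1.
have AE x : A x <-> forall i, `|x - xA i| < rA i.
  by split=> [Ax i|Ax i _]; [exact: Ax|exact: Ax].
have NBE x : ~ B x <-> rB < `|x - xB|.
  by split=> [/negP|h]; [rewrite -ltNge|apply/negP; rewrite -ltNge].
pose d := xA i0 - xB.
have out x s : (A `\` B) x -> 0 <= s -> rB < `|x + s *: d - xB|.
  move=> [/AE Ax /NBE Bx] s0; apply: ray_outside_ball => //.
  by rewrite ltW // (lt_trans (Ax i0)).
have d0 : d != 0.
  rewrite subr_eq0; apply/eqP => aE.
  move/AE/(_ i0): Ap; move/NBE: NBp; rewrite aE => h1 h2.
  by have := rA_lt i0; lra.
have [pi kerpi] := linear_form_kernel_sub_line dimX d0.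
pose f x := `|x - xB| - rB.
(* positive exactly on A; the default value is one of the terms, so it does not
   interfere *)
pose mA x := \big[Num.min/rA i0 - `|x - xA i0|]_i (rA i - `|x - xA i|).
have mAP x : reflect (A x) (0 < mA x).
  apply: (iffP (bigmin_gtP _ _ _ _)) => [[_ h]|/AE h].
    by apply/AE => i; rewrite -subr_gt0; exact: h.
  by split=> [|i _]; rewrite subr_gt0.
have mAL x y : mA x <= mA y + `|x - y|.
  rewrite -lerBlDr; apply/bigmin_geP; split=> [|i _]; rewrite lerBlDr.
    rewrite (le_trans (bigmin_le _ i0 _)) //.
    by have := dist_lipschitz (xA i0) y x; rewrite [`|y - x|]distrC; lra.
  rewrite (le_trans (bigmin_le _ i _)) //.
  by have := dist_lipschitz (xA i) y x; rewrite [`|y - x|]distrC; lra.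
have fL x y : f x <= f y + `|x - y|.
  by have := dist_lipschitz xB x y; rewrite /f; lra.
pose m x := Num.min (mA x) (f x).
have Em x : (A `\` B) x <-> 0 < m x.
  rewrite /m lt_min /f subr_gt0; split=> [[/mAP -> /NBE ->]|] //.
  by case/andP => /mAP Ax /NBE.
have mL x y : m x <= m y + `|x - y|.
  by rewrite -lerBlDr le_min !lerBlDr !ge_min mAL fL orbT.
(* a longer step along d leaves the ball around xA i0 *)
pose C := 2 * rA i0 / `|d|.
have r0 : 0 < rA i0 by move/AE/(_ i0): Ap; exact: le_lt_trans.
have C0 : 0 <= C by rewrite divr_ge0 // mulr_ge0 // ltW.
apply: (contractible_of_fibres C0 Em mL); last by exists p.
  move=> x s t Ex Exs ts; split; last first.
    by apply/NBE/out => //; case/andP: ts.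
  apply/AE => i; apply: between_in_ball ts.
    by case: Ex => /AE.
  by case: Exs => /AE.
move=> x y l Ex Ey l01; set z := l *: x + (1 - l) *: y.
have Az : A z.
  apply/AE => i; apply: convex_comb_in_ball => //.
    by case: Ex => /AE.
  by case: Ey => /AE.
have [zB|zB] := pselect (B z); last first.
  by exists 0; [rewrite lexx|rewrite scale0r addr0].
(* at a zero of k the point z + t d is in E, or else it would be in B, hence in
   A by the cap lemma, and k would be positive *)
pose k t := mA (z + t *: d) - Num.max 0 (f (z + t *: d)).
have kc : continuous k.
  pose g x := mA x - Num.max 0 (f x).
  have gc : continuous g.
    apply: (@lipschitz_continuous _ _ _ 2) => u v; rewrite /g.
    have : Num.max 0 (f v) <= Num.max 0 (f u) + `|u - v|.
      rewrite ge_max addr_ge0 ?le_max ?lexx //= distrC.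
      by rewrite (le_trans (fL v u)) // lerD2r le_max lexx orbT.
    by have := mAL u v; lra.
  have lc : continuous (fun s : R => z + s *: d).
    by move=> s; apply: cvgD; [exact: cvg_cst|exact: scalel_continuous].
  by move=> t; exact: (continuous_comp (lc t) (gc _)).
have k0 : 0 < k 0.
  rewrite /k scale0r addr0 max_l; last by rewrite /f subr_le0.
  by rewrite subr0; apply/mAP.
have kC : k C < 0.
  have : mA (z + C *: d) <= rA i0 - `|z + C *: d - xA i0| by exact: bigmin_le.
  have := ler_normB (z + C *: d - xA i0) (z - xA i0).
  have -> : z + C *: d - xA i0 - (z - xA i0) = C *: d.
    by rewrite opprB addrA subrK addrAC subrr add0r.
  have : 0 <= Num.max 0 (f (z + C *: d)) by rewrite le_max lexx.
  rewrite normrZ (ger0_norm C0) divfK ?normr_eq0 // /k.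
  by have /AE/(_ i0) := Az; lra.
have [t /[!in_itv]/= tC kt] : exists2 t, t \in `[0, C] & k t = 0.
  apply: IVT => //; first exact: continuous_subspaceT.
  by rewrite ge_min le_max (ltW k0) (ltW kC) orbT.
exists t => //.
have [ft|ft] := leP (f (z + t *: d)) 0.
  have bB : B (z + t *: d) by move: ft; rewrite /f subr_le0.
  have /mAP : A (z + t *: d).
    apply/AE => i.
    apply: (cap_sub_smaller_ball kerpi (rA_lt i) l01) zB bB.
    - by case/andP: tC.
    - by case: Ex => /AE.
    - by case: Ey => /AE.
    - by move=> s; exact: out.
    - by move=> s; exact: out.
  by move: kt; rewrite /k max_l // subr0 => ->; rewrite ltxx.
apply/Em; rewrite /m lt_min ft andbT.
by move/eqP: kt; rewrite /k max_r ?ltW // subr_eq0 => /eqP ->.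
Qed.
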